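(* Under the Simplicial Vertex Hypothesis, any algorithm achieving approximation ratio better than $5/3$ for $n$-Pairs Diameter in undirected graphs requires $n^{\omega-o(1)}$ time.
   Context: $n$-Pairs Diameter: given a graph with $n$ vertices and $O(n)$ vertex pairs $(s_i,t_i)$, compute $\max_i d(s_i,t_i)$ (shortest-path distance). Approximation ratio $\alpha$ means output $\hat x$ with $x\le\hat x\le\alpha x$. $\omega$ is the matrix multiplication exponent. A simplicial vertex in an undirected graph is a vertex whose neighborhood induces a clique. Simplicial Vertex Hypothesis: in the word-RAM model with $O(\log n)$-bit words, for any constant $\varepsilon>0$ there is no $O(n^{\omega-\varepsilon})$-time algorithm for detecting a simplicial vertex in an $n$-vertex graph. *)

(* Defs.v *)
From mathcomp Require Import all_boot all_order all_algebra.
From mathcomp Require Import classical_sets reals exp.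

Set Implicit Arguments.
Unset Strict Implicit.
Unset Printing Implicit Defensive.

Import Order.TTheory GRing.Theory Num.Theory.

Local Open Scope ring_scope.

(** * The matrix multiplication exponent *)

(** Straight-line programs over [F].  Operands are indices into the list formed
    by the inputs followed by the results of the instructions already executed. *)
Inductive arith_instr (F : Type) : Type :=
  | ArithConst of F
  | ArithAdd of nat & nat
  | ArithSub of nat & nat
  | ArithMul of nat & nat.

Definition arith_step (F : fieldType) (S : comAlgType F) (v : seq S)
    (c : arith_instr F) : seq S :=
  rcons v match c with
          | ArithConst a => a%:A
          | ArithAdd i j => v`_i + v`_j
          | ArithSub i j => v`_i - v`_j
          | ArithMul i j => v`_i * v`_j
          end.

Definition mx_entries (T : Type) (n : nat) (A : 'M[T]_n) : seq T :=
  [seq A i j | i <- enum 'I_n, j <- enum 'I_n].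

(** [out i j] is the position of the entry [(i, j)] of the product.  Correctness
    in every commutative [F]-algebra [S] means correctness as an identity between
    formal polynomials in the entries, including when [F] is finite. *)
Definition computes_mulmx (F : fieldType) (n : nat) (p : seq (arith_instr F))
    (out : 'I_n -> 'I_n -> nat) : Prop :=
  forall (S : comAlgType F) (A B : 'M[S]_n),
    \matrix_(i, j) (foldl (@arith_step F S) (mx_entries A ++ mx_entries B) p)`_(out i j)
    = A *m B.

Definition mulmx_in_ops (F : fieldType) (n m : nat) : Prop :=
  exists (p : seq (arith_instr F)) (out : 'I_n -> 'I_n -> nat),
    computes_mulmx p out /\ size p = m.

Definition omega (R : realType) (F : fieldType) : R :=
  inf [set tau : R | exists C : R, forall n : nat, (0 < n)%N ->
         exists2 m : nat, mulmx_in_ops F n m & m%:R <= C * n%:R `^ tau].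

(** * The word RAM *)

Local Open Scope nat_scope.

Inductive word_op : Type :=
  | OpAdd | OpSub | OpMul | OpDiv | OpMod | OpAnd | OpOr | OpXor | OpShl | OpShr.

(** Operands of the instructions are register numbers; the last argument of a
    jump is its target. *)
Inductive instr : Type :=
  | SetConst (d c : nat)             (* r_d := c *)
  | Oper (o : word_op) (d x y : nat) (* r_d := r_x o r_y *)
  | ReadMem (d x : nat)              (* r_d := mem[r_x] *)
  | WriteMem (x y : nat)             (* mem[r_x] := r_y *)
  | JumpLt (x y l : nat)             (* if r_x < r_y goto l *)
  | JumpEq (x y l : nat).            (* if r_x = r_y goto l *)

Record state : Type := State {
  pc : nat;
  reg : nat -> nat;
  memory : nat -> nat }.

Definition word_op_eval (w : nat) (o : word_op) (x y : nat) : nat :=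
  match o with
  | OpAdd => x + y
  | OpSub => x + (2 ^ w - y)
  | OpMul => x * y
  | OpDiv => x %/ y
  | OpMod => x %% y
  | OpAnd => Nat.land x y
  | OpOr => Nat.lor x y
  | OpXor => Nat.lxor x y
  | OpShl => x * 2 ^ y
  | OpShr => x %/ 2 ^ y
  end %% 2 ^ w.

Definition exec (w : nat) (c : instr) (s : state) : state :=
  let: State i r m := s in
  match c with
  | SetConst d a => State i.+1 [eta r with d |-> a %% 2 ^ w] m
  | Oper o d x y => State i.+1 [eta r with d |-> word_op_eval w o (r x) (r y)] m
  | ReadMem d x => State i.+1 [eta r with d |-> m (r x)] m
  | WriteMem x y => State i.+1 r [eta m with r x |-> r y]
  | JumpLt x y l => State (if r x < r y then l else i.+1) r m
  | JumpEq x y l => State (if r x == r y then l else i.+1) r m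
  end.

(** A program halts when control leaves it; halted states are fixed points. *)
Definition halted (P : seq instr) (s : state) : bool := size P <= pc s.

Definition step (w : nat) (P : seq instr) (s : state) : state :=
  if halted P s then s else exec w (nth (SetConst 0 0) P (pc s)) s.

Definition init (input : seq nat) : state :=
  State 0 (fun=> 0) (nth 0 input).

(** On instances with parameter [n], the words have
    [word_slope * floor (log2 n) + word_offset] bits. *)
Record algorithm : Type := Algorithm {
  program : seq instr;
  word_slope : nat;
  word_offset : nat }.

Definition word_length (A : algorithm) (n : nat) : nat :=
  word_slope A * trunc_log 2 n + word_offset A.

(** Words are required to be long enough to hold and to address the input. *)
Definition fits (w : nat) (input : seq nat) : Prop :=
  size input < 2 ^ w /\ all (fun x => x < 2 ^ w) input.

Definition computes_within (R : realType) (A : algorithm) (n : nat)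
    (input : seq nat) (T : R) (correct : (nat -> nat) -> Prop) : Prop :=
  let w := word_length A n in
  fits w input /\
  exists t : nat,
    let s := iter t (step w (program A)) (init input) in
    [/\ (t%:R <= T)%R, halted (program A) s & correct (memory s)].

(** * Graphs *)

Definition simple_graph (n : nat) (e : rel 'I_n) : Prop :=
  symmetric e /\ irreflexive e.

Definition encode_graph (n : nat) (e : rel 'I_n) : seq nat :=
  n :: [seq (e i j : nat) | i <- enum 'I_n, j <- enum 'I_n].

Definition simplicial (n : nat) (e : rel 'I_n) (v : 'I_n) : bool :=
  [forall x, forall y, [&& e v x, e v y & x != y] ==> e x y].

(** A nonzero value in cell 0 means acceptance. *)
Definition detects_simplicial_in (R : realType) (A : algorithm) (T : nat -> R) : Prop :=
  forall (n : nat) (e : rel 'I_n), 0 < n -> simple_graph e ->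
    computes_within A n (encode_graph e) (T n)
      (fun m => (m 0 != 0) = [exists v, simplicial e v]).

Definition simplicial_vertex_hypothesis (R : realType) (F : fieldType) : Prop :=
  forall eps : R, (0 < eps)%R ->
    ~ exists (A : algorithm) (C : R),
        detects_simplicial_in A (fun n => C * n%:R `^ (omega R F - eps))%R.

Definition walk (T : finType) (e : rel T) (x y : T) (k : nat) : bool :=
  [exists p : k.-tuple T, path e x p && (last x p == y)].

(** The least length of a walk from [x] to [y]; it is the shortest-path distance
    when [y] is reachable from [x], and the junk value [#|T|] otherwise. *)
Definition dist (T : finType) (e : rel T) (x y : T) : nat :=
  find (walk e x y) (iota 0 #|T|).

Definition pairs_diameter (n : nat) (e : rel 'I_n) (ps : seq ('I_n * 'I_n)) : nat :=
  \max_(p <- ps) dist e p.1 p.2.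

Definition encode_pairs_instance (n : nat) (e : rel 'I_n) (ps : seq ('I_n * 'I_n)) :
    seq nat :=
  encode_graph e ++ size ps :: flatten [seq [:: val p.1; val p.2] | p <- ps].

(** The estimate is the rational number whose numerator and denominator are left
    in cells 0 and 1.  Nothing is required of the algorithm on instances in which
    some pair is disconnected, where the maximum is not a finite number. *)
Definition approximates_pairs_diameter_in (R : realType) (alpha : R) (K : nat)
    (A : algorithm) (T : nat -> R) : Prop :=
  forall (n : nat) (e : rel 'I_n) (ps : seq ('I_n * 'I_n)),
    0 < n -> simple_graph e -> 0 < size ps <= K * n ->
    all (fun p => connect e p.1 p.2) ps ->
    let x : R := ((pairs_diameter e ps)%:R)%R in
    computes_within A n (encode_pairs_instance e ps) (T n)
      (fun m => 0 < m 1 /\ (x <= (m 0)%:R / (m 1)%:R <= alpha * x)%R).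

(* Main.v *)
Require Import Defs.
From mathcomp Require Import all_boot all_order all_algebra.
From mathcomp Require Import classical_sets reals exp.
From mathcomp Require Import boolp zify lra.

Set Implicit Arguments.
Unset Strict Implicit.
Unset Printing Implicit Defensive.

Import Order.TTheory GRing.Theory Num.Theory.

(** From a graph [G] on [n] vertices build a bipartite gadget with copies [s_v],
    [x_v], [y_v], [t_v] of every vertex, where [s_v - x_u] and [y_u - t_v] are the
    edges of [G] and [x_u - y_u'] the pairs of distinct non-neighbours.  Then
    [d(s_v, t_v) = 3] exactly when [v] is not simplicial; by bipartiteness the
    distance is otherwise at least 5, and a private path of length 5 keeps every
    pair connected.  An approximation within a factor less than 5/3 separates the
    two cases, so a word-RAM program that writes the gadget over its input and then
    runs the given algorithm detects simplicial vertices with an overhead of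
    [O(n^2)] steps.

    The overhead is harmless only if [omega - eps >= 2].  If [omega - eps < 2], no
    hypothesis is needed: on the gadget of the complete graph without the [x - y]
    edges, where the maximum is at least 5, the algorithm leaves unread the cells
    of some pair [x_u, y_u'], and adding that edge lowers all the distances to 3
    without changing the run. *)

Local Open Scope ring_scope.
Local Open Scope nat_scope.

(** * The gadget graph *)

Section Gadget.
Variables (n : nat) (E f : rel nat).

(* Vertex [v] of block [b] is numbered [b * n + v]; blocks 1, 2, 3, 4 hold the
   [s_v], [x_v], [y_v], [t_v], and the remaining vertices are isolated, except for
   the private paths through blocks 6, 5, 8, 7, numbered so that the parity of the
   block is the bipartition.  Block 0 is isolated so that the cells of the gadget
   that hold a 1 do not overlap the matrix of the input graph, and [16 n] vertices
   are taken because [trunc_log 2 (16 * n)] is determined by [trunc_log 2 n], so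
   that both instances can have the same word length. *)
Definition path_blocks : seq (nat * nat) :=
  [:: (1, 6); (6, 5); (5, 8); (8, 7); (7, 4)].

Definition block_arc (i j : nat) : bool :=
  let p := (i %/ n, j %/ n) in
  [|| (p \in [:: (1, 2); (3, 4)]) && E (i %% n) (j %% n),
      (p == (2, 3)) && f (i %% n) (j %% n)
    | (p \in path_blocks) && (i %% n == j %% n)].

Definition edge (i j : nat) : bool := block_arc i j || block_arc j i.

Definition gadget : rel 'I_(16 * n) := fun i j => edge i j.

Lemma block_lt b v : b < 16 -> v < n -> b * n + v < 16 * n.
Proof. nia. Qed.

Definition vertex b (hb : b < 16) (v : 'I_n) : 'I_(16 * n) :=
  Ordinal (block_lt hb (ltn_ord v)).

Definition source := @vertex 1 isT.
Definition target := @vertex 4 isT.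

Definition gadget_pairs : seq ('I_(16 * n) * 'I_(16 * n)) :=
  [seq (source v, target v) | v <- enum 'I_n].

Lemma div_block b v : v < n -> (b * n + v) %/ n = b.
Proof. by move=> vn; rewrite divnMDl ?divn_small ?addn0 //; lia. Qed.

Lemma mod_block b v : v < n -> (b * n + v) %% n = v.
Proof. by move=> vn; rewrite modnMDl modn_small. Qed.

Lemma edge_sym : symmetric edge.
Proof. by move=> i j; rewrite /edge orbC. Qed.

Lemma block_arc_parity i j : block_arc i j -> odd (i %/ n) != odd (j %/ n).
Proof.
by case/or3P=> /andP[H _]; move: H; rewrite ?inE; move=> H;
  repeat (case/orP: H => H || case/eqP: H => -> ->).
Qed.

Lemma edge_parity i j : edge i j -> odd (i %/ n) = ~~ odd (j %/ n).
Proof.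
by case/orP=> /block_arc_parity; case: (odd _); case: (odd _).
Qed.

Lemma edge_irr : irreflexive edge.
Proof. by move=> i; apply/negP=> /edge_parity; case: odd. Qed.

Lemma gadget_simple : simple_graph gadget.
Proof. by split=> [i j|i]; [apply: edge_sym | apply: edge_irr]. Qed.

(** Sources lie in block 1 and targets in block 4, so every walk joining a pair has odd length. *)
Lemma path_parity i (p : seq 'I_(16 * n)) : path gadget i p ->
  odd (last i p %/ n) = odd (i %/ n) (+) odd (size p).
Proof.
elim: p i => [|j p IHp] i /=; first by rewrite addbF.
by case/andP=> /edge_parity -> /IHp ->; case: (odd (j %/ n)); case: (odd (size p)).
Qed.

Lemma dist_le (T : finType) (e : rel T) x y k : k < #|T| -> walk e x y k -> dist e x y <= k.
Proof.
move=> kT w; rewrite leqNgt; apply/negP => /(before_find 0).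
by rewrite nth_iota // add0n w.
Qed.

(** The bound [k <= #|T|] covers unreachable vertices too, whose [dist] is the default [#|T|]. *)
Lemma dist_ge (T : finType) (e : rel T) x y k : k <= #|T| ->
  (forall l, l < k -> ~~ walk e x y l) -> k <= dist e x y.
Proof.
move=> kT H; rewrite leqNgt; apply/negP => lt.
have h : has (walk e x y) (iota 0 #|T|) by rewrite has_find size_iota; apply: leq_trans lt kT.
have := nth_find 0 h; rewrite nth_iota ?add0n; last exact: leq_trans lt kT.
by apply/negP/H.
Qed.

Lemma walkP (T : finType) (e : rel T) x y p :
  path e x p -> last x p = y -> walk e x y (size p).
Proof. by move=> ep lp; apply/existsP; exists (in_tuple p); rewrite ep lp /=. Qed.

Lemma gadget_connected v : connect gadget (source v) (target v).
Proof.
apply/connectP.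
exists [:: @vertex 6 isT v; @vertex 5 isT v; @vertex 8 isT v; @vertex 7 isT v; target v] => //.
by rewrite /= /gadget /edge /block_arc /= !div_block ?mod_block // !inE !eqxx /= ?orbT.
Qed.

Lemma dist_le3 (v x y : 'I_n) : E v x -> f x y -> E y v ->
  dist gadget (source v) (target v) <= 3.
Proof.
move=> vx xy yv; apply: dist_le; first by rewrite card_ord; have := ltn_ord v; lia.
apply: (@walkP _ _ _ _ [:: @vertex 2 isT x; @vertex 3 isT y; target v]) => //.
by rewrite /= /gadget /edge /block_arc /= !div_block ?mod_block // !inE !eqxx /= vx xy yv.
Qed.

(** Parity leaves only the lengths 1 and 3 to exclude. The neighbours of the source lie in blocks 2
    and 6, those of the target in blocks 3 and 7, and of these only blocks 2 and 3 are joined,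
    through [f]. *)
Lemma dist_ge5 (v : 'I_n) : (forall x y : 'I_n, E v x -> f x y -> ~~ E y v) ->
  5 <= dist gadget (source v) (target v).
Proof.
move=> H; have n0 : 0 < n by have := ltn_ord v; lia.
apply: dist_ge; first by rewrite card_ord; lia.
move=> l l5; apply/existsP => -[[p /= /eqP sp] /andP[pp /eqP lp]].
have := path_parity pp; rewrite lp sp /= !div_block //=.
have sE b u : u < n -> edge (1 * n + v) (b * n + u) -> b = 2 /\ E v u \/ b = 6.
  move=> un; rewrite /edge /block_arc !div_block ?mod_block // !inE !xpair_eqE.
  rewrite !eqE /= !eqnE !andbF !orbF /=.
  by case/orP=> /andP[/eqP-> Ev]; [left | right].
have tE b u : u < n -> edge (b * n + u) (4 * n + v) -> b = 3 /\ E u v \/ b = 7.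
  move=> un; rewrite /edge /block_arc !div_block ?mod_block // !inE !xpair_eqE.
  rewrite !eqE /= !eqnE !andbF !orbF !andbT /=.
  by case/orP=> /andP[/eqP-> Ev]; [left | right].
case: p sp pp lp => [|a [|b [|c [|d p]]]] /= sp; rewrite -sp // /gadget.
- by rewrite andbT => + ac; rewrite ac /= => /sE; rewrite ltn_ord; lia.
- case/and4P=> ea ab bc _ ct _; move: ea ab bc; rewrite ct /=.
  rewrite (divn_eq a n) (divn_eq b n).
  have [ua ub] := (ltn_pmod a n0, ltn_pmod b n0).
  move: (a %/ n) (a %% n) (b %/ n) (b %% n) ua ub => ba x bb y ua ub.
  move=> /(sE _ _ ua) [[a2 va]|a6] eab /(tE _ _ ub) [[b3 bv]|b7]; move: eab;
    rewrite ?a2 ?a6 ?b3 ?b7 /edge /block_arc !div_block ?mod_block // !inE !xpair_eqE !eqE /=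
      ?orbF //.
  move=> fab; have := H (Ordinal ua) (Ordinal ub) va fab.
  by rewrite /= bv.
- by case: p sp => [_ _ _ //|e p] sp; move: l5; rewrite -sp.
Qed.

Lemma gadget_diam_le : (forall v : 'I_n, exists x y : 'I_n, [/\ E v x, f x y & E y v]) ->
  pairs_diameter gadget gadget_pairs <= 3.
Proof.
move=> H; apply/bigmax_leqP_seq => p /mapP[v _ ->] _ /=.
by have [x [y [vx xy yv]]] := H v; apply: dist_le3 vx xy yv.
Qed.

Lemma gadget_diam_ge (v : 'I_n) : (forall x y : 'I_n, E v x -> f x y -> ~~ E y v) ->
  5 <= pairs_diameter gadget gadget_pairs.
Proof.
move=> /dist_ge5 H; apply: leq_trans H _.
apply: (@leq_bigmax_seq _ _ _ (fun p => dist gadget p.1 p.2) (source v, target v)) => //.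
by apply/mapP; exists v; rewrite ?mem_enum.
Qed.

Lemma gadget_pairs_connected : all (fun p => connect gadget p.1 p.2) gadget_pairs.
Proof. by apply/allP => p /mapP[v _ ->]; apply: gadget_connected. Qed.

Lemma size_gadget_pairs : size gadget_pairs = n.
Proof. by rewrite size_map size_enum_ord. Qed.

End Gadget.

(** * Encoding of the gadget *)

Lemma nth_allpairs (S T : Type) (x0 : S) (y0 : T) (f : S -> T -> nat) s t i j :
  i < size s -> j < size t ->
  nth 0 [seq f x y | x <- s, y <- t] (i * size t + j) = f (nth x0 s i) (nth y0 t j).
Proof.
elim: s i => [|x s IHs] [|i] //= ilt jlt; rewrite nth_cat size_map.
  by rewrite mul0n add0n jlt (nth_map y0).
by rewrite mulSn -addnA ltnNge leq_addr /= addKn IHs.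
Qed.

Lemma size_encode_graph n (e : rel 'I_n) : size (encode_graph e) = (n * n).+1.
Proof. by rewrite /= size_allpairs size_enum_ord. Qed.

Lemma nth_encode_graph n (e : rel 'I_n) (i j : 'I_n) :
  nth 0 (encode_graph e) (i * n + j).+1 = e i j.
Proof.
have se := size_enum_ord n.
have := @nth_allpairs _ _ i j (fun x y => e x y : nat) (enum 'I_n) (enum 'I_n) i j.
by rewrite !nth_ord_enum se; apply.
Qed.

Section Encoding.
Variables (n : nat) (E f : rel nat).

(* Every address beyond cell 0 is [cell i j] for a unique [j < 16 n]; the row
   [i = 16 n] starts the list of pairs. *)
Definition cell (i j : nat) : nat := (i * (16 * n) + j).+1.

Definition gadget_input : seq nat :=
  encode_pairs_instance (gadget E f) (gadget_pairs n).

Definition final_cell (a : nat) : nat := nth 0 gadget_input a.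

Lemma final_cell_edge i j : i < 16 * n -> j < 16 * n ->
  final_cell (cell i j) = edge n E f i j.
Proof.
move=> il jl; rewrite /final_cell /gadget_input /encode_pairs_instance nth_cat.
rewrite size_encode_graph ifT; last by rewrite ltnS /cell; nia.
exact: (nth_encode_graph _ (Ordinal il) (Ordinal jl)).
Qed.

Lemma final_cell_tail j : final_cell (cell (16 * n) j) =
  nth 0 (n :: flatten [seq [:: val p.1; val p.2] | p <- gadget_pairs n]) j.
Proof.
rewrite /final_cell /gadget_input /encode_pairs_instance nth_cat size_encode_graph.
by rewrite ifF ?size_gadget_pairs; [congr nth | ]; rewrite /cell; lia.
Qed.

Lemma final_cell_size : final_cell (cell (16 * n) 0) = n.
Proof. by rewrite final_cell_tail. Qed.

Lemma nth_pairs (T : Type) (F G : T -> nat) (x0 : T) s v : v < size s ->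
  let l := flatten [seq [:: F p; G p] | p <- s] in
  (nth 0 l v.*2 = F (nth x0 s v)) * (nth 0 l v.*2.+1 = G (nth x0 s v)).
Proof. by elim: s v => [|x s IHs] [|v] //=; apply: IHs. Qed.

Lemma final_cell_pair v : v < n ->
  (final_cell (cell (16 * n) (v + v).+1) = n + v) *
  (final_cell (cell (16 * n) (v + v).+2) = 4 * n + v).
Proof.
move=> vn; rewrite !final_cell_tail addnn.
have vs : v < size (gadget_pairs n) by rewrite size_gadget_pairs.
pose x0 := (source (Ordinal vn), target (Ordinal vn)).
have [H1 H2] := @nth_pairs _ (fun p => val p.1) (fun p => val p.2) x0 _ _ vs.
rewrite [nth _ _ _]H1 [X in (_ * (X = _))%type]H2 /gadget_pairs.
rewrite (nth_map (Ordinal vn)) ?size_enum_ord //.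
by rewrite -[v in nth _ _ v]/(val (Ordinal vn)) nth_ord_enum /= mul1n.
Qed.

Lemma size_gadget_input : size gadget_input = (16 * n * (16 * n) + n.*2).+2.
Proof.
rewrite size_cat size_encode_graph /= size_flatten /shape -map_comp.
rewrite (eq_map (g := fun=> 2)) // -[n in n.*2]size_gadget_pairs.
set s := gadget_pairs n; have -> : sumn [seq 2 | _ <- s] = (size s).*2 by elim: s => //= _ s ->.
by rewrite addSn addnS.
Qed.

Lemma final_cell_out a : (16 * n * (16 * n) + n.*2).+2 <= a -> final_cell a = 0.
Proof. by move=> h; rewrite /final_cell nth_default // size_gadget_input. Qed.

End Encoding.

(** * The program writing the gadget *)

Definition straight (c : instr) : bool :=
  match c with JumpLt _ _ _ | JumpEq _ _ _ => false | _ => true end.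

Definition run (w : nat) (s : state) (code : seq instr) : state :=
  foldl (fun s c => exec w c s) s code.

Lemma pc_exec w c s : straight c -> pc (exec w c s) = (pc s).+1.
Proof. by case: c; case: s. Qed.

Lemma run_cat w s c1 c2 : run w s (c1 ++ c2) = run w (run w s c1) c2.
Proof. exact: foldl_cat. Qed.

Lemma pc_run w code s : all straight code -> pc (run w s code) = pc s + size code.
Proof.
elim: code s => [|c code IH] s /=; first by rewrite addn0.
by case/andP=> sc /IH ->; rewrite pc_exec // addSnnS.
Qed.

Lemma step_at w pre c post s : pc s = size pre ->
  step w (pre ++ c :: post) s = exec w c s.
Proof.
move=> ps; rewrite /step /halted ps nth_cat ltnn subnn /= ifF //.
by rewrite size_cat /=; lia.
Qed.

Lemma iter_run w pre code post s : all straight code -> pc s = size pre ->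
  iter (size code) (step w (pre ++ code ++ post)) s = run w s code.
Proof.
elim: code pre s => [|c code IH] pre s //= /andP[sc scs] ps.
rewrite -iterS iterSr step_at // -cat_rcons IH // size_rcons -ps.
exact: pc_exec.
Qed.

(* [(b1, i, b2, j, x)] sets the cell of row [b1 * n + r_i] and column
   [b2 * n + r_j] to [r_x].  Registers 1, 2 and 9 hold [n], [16 n] and [1];
   registers 14 and 15 are scratch. *)
Definition cell_write : Type := (nat * nat * nat * nat * nat)%type.

Definition write_code (s : cell_write) : seq instr :=
  let: (b1, i, b2, j, x) := s in
  [:: SetConst 14 b1; Oper OpMul 14 14 1; Oper OpAdd 14 14 i; Oper OpMul 14 14 2;
      SetConst 15 b2; Oper OpMul 15 15 1; Oper OpAdd 15 15 j;
      Oper OpAdd 14 14 15; Oper OpAdd 14 14 9; WriteMem 14 x].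

Definition write_addr (n : nat) (r : nat -> nat) (s : cell_write) : nat :=
  let: (b1, i, b2, j, _) := s in cell n (b1 * n + r i) (b2 * n + r j).

Definition write_regs (s : cell_write) : seq nat := let: (_, i, _, j, x) := s in [:: i; j; x].

Definition write_value (r : nat -> nat) (s : cell_write) : nat := r s.2.

Definition apply_writes n r (ws : seq cell_write) (m : nat -> nat) : nat -> nat :=
  foldl (fun m s => [eta m with write_addr n r s |-> write_value r s]) m ws.

Lemma write_ext n r r' s : all (fun d => d < 14) (write_regs s) ->
  (forall d, d < 14 -> r' d = r d) ->
  write_addr n r' s = write_addr n r s /\ write_value r' s = write_value r s.
Proof.
move=> s14 eqr; move: s14; case: s => [[[[b1 i] b2] j] x] /= /and4P[i14 j14 x14 _].
by rewrite /write_value /= !eqr.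
Qed.

Lemma run_write_code w n p r m s :
  r 1 = n -> r 2 = 16 * n -> r 9 = 1 -> all (fun d => d < 14) (write_regs s) ->
  write_addr n r s < 2 ^ w ->
  exists2 r', forall d, d \notin [:: 14; 15] -> r' d = r d &
    run w (State p r m) (write_code s) =
    State (p + 10) r' [eta m with write_addr n r s |-> write_value r s].
Proof.
case: s => [[[[b1 i] b2] j] x] r1 r2 r9 /and4P[i14 j14 x14 _] aw.
have ne (d : nat) : d < 14 -> ((d == 14) = false) * ((d == 15) = false).
  by move=> d14; rewrite !ltn_eqF // (ltn_trans d14).
rewrite /run /= !ne //= r1 r2 r9; eexists; last first.
  rewrite addnC; congr State; congr (fun a => [eta m with a |-> r x]).
  (* Reduction modulo [2 ^ w] commutes with sums and products, so only the final address has to be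
     small. *)
  rewrite /word_op_eval (modnMml b1) (modnMml b2) (modnDml (b1 * n)) (modnDml (b2 * n)).
  rewrite (modnMml (_ + _)) (modnDml (_ * _)) modnDmr modnDml modn_small addn1 //.
by move=> d /=; rewrite !inE; case: eqP => //=; case: eqP.
Qed.

Lemma run_writes w n p r m ws :
  r 1 = n -> r 2 = 16 * n -> r 9 = 1 ->
  all (fun s => all (fun d => d < 14) (write_regs s)) ws ->
  all (fun s => write_addr n r s < 2 ^ w) ws ->
  exists2 r', forall d, d \notin [:: 14; 15] -> r' d = r d &
    run w (State p r m) (flatten (map write_code ws)) =
    State (p + 10 * size ws) r' (apply_writes n r ws m).
Proof.
move=> r1 r2 r9 wsr wsw.
suff H r' : (forall d, d \notin [:: 14; 15] -> r' d = r d) ->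
    exists2 r2, forall d, d \notin [:: 14; 15] -> r2 d = r d &
    run w (State p r' m) (flatten (map write_code ws)) =
    State (p + 10 * size ws) r2 (apply_writes n r ws m).
  exact: H.
elim: ws p m r' wsr wsw => [|s ws IH] p m r' /=.
  by move=> _ _ Hr'; exists r' => //=; rewrite addn0.
move=> /andP[s14 ws14] /andP[sw wsw] Hr'.
have eqr d : d < 14 -> r' d = r d.
  by move=> d14; apply: Hr'; rewrite !inE !ltn_eqF // (ltn_trans d14).
have [Ea Ev] := write_ext n s14 eqr.
have [|||||r2' Hr2 E2] := @run_write_code w n p r' m s; rewrite ?eqr ?Ea //.
have [|||r3 Hr3 E3] := IH (p + 10) [eta m with write_addr n r s |-> write_value r s] r2' => //.
  by move=> d dn; rewrite Hr2 // Hr'.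
exists r3 => //; rewrite run_cat E2 Ea Ev E3; congr State; lia.
Qed.

(** Writes that all store the values prescribed by [fin] cannot conflict, so neither their order nor
    repetitions matter. *)
Lemma apply_writesE n r ws m fin :
  all (fun s => fin (write_addr n r s) == write_value r s) ws -> forall a,
  apply_writes n r ws m a = if a \in map (write_addr n r) ws then fin a else m a.
Proof.
elim: ws m => //= s ws IH m /andP[/eqP fs Hws] a; rewrite IH // inE /=.
by case: ifP => _; rewrite ?orbT ?orbF //; case: eqP => // ->.
Qed.

(** Here [k] encodes the pair [(v, x)] and [b] is its adjacency bit. Entry 8 is the non-adjacency
    bit, entries 10 and 11 locate the pair of [v] in row [16 n], and 12 and 13 are the numbers of
    [s_v] and [t_v]. *)
Definition loop_regs (n k b : nat) : nat -> nat :=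
  let v := k %/ n in let x := k %% n in
  nth 0 [:: 0; n; 16 * n; n * n; k; v; x; b; (v != x) - b; 1; (v + v).+1; (v + v).+2;
            n + v; 4 * n + v].

(* Division by zero yields zero, so [r8 / r8] is the truth value of [r8 <> 0]. *)
Definition loop_setup : seq instr :=
  [:: Oper OpDiv 5 4 1; Oper OpMod 6 4 1; Oper OpAdd 14 4 9; ReadMem 7 14;
      Oper OpSub 8 6 5; Oper OpDiv 8 8 8; Oper OpSub 8 8 7;
      Oper OpAdd 10 5 5; Oper OpAdd 10 10 9; Oper OpAdd 11 10 9; Oper OpAdd 12 1 5;
      SetConst 13 4; Oper OpMul 13 13 1; Oper OpAdd 13 13 5].

Definition both_ways (b1 b2 i j x : nat) : seq cell_write :=
  [:: (b1, i, b2, j, x); (b2, j, b1, i, x)].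

(** The last four writes erase the input cell just read and store the number of pairs and the pair
    of [v]. Writes depending on [v] alone are repeated for every [x], which keeps the body free of
    jumps. *)
Definition loop_writes : seq cell_write :=
  both_ways 1 2 5 6 7 ++ both_ways 3 4 5 6 7 ++ both_ways 2 3 5 6 8 ++
  flatten [seq both_ways p.1 p.2 5 5 9 | p <- path_blocks] ++
  [:: (0, 0, 0, 4, 0); (16, 0, 0, 0, 1); (16, 0, 0, 10, 12); (16, 0, 0, 11, 13)].

Definition loop_body : seq instr :=
  loop_setup ++ flatten (map write_code loop_writes) ++ [:: Oper OpAdd 4 4 9].

(** Modulo [B] the difference [z] vanishes only for [x = v], so [z %/ z] is the bit [v != x]. On the
    diagonal [b] is 0, hence subtracting [b] never wraps around. *)
Lemma flag_mod (B x v : nat) (b : bool) : 1 < B -> x < B -> v < B -> (v == x -> ~~ b) ->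
  let z := (x + (B - v)) %% B in ((z %/ z) %% B + (B - b)) %% B = (v != x) - b.
Proof.
move=> B1 xB vB; case: eqP => [-> /(_ isT)|vx _] /=.
  by case: b => // _; rewrite subnKC ?modnn ?mod0n ?subn0 ?modnn // ltnW.
rewrite divnn; have -> : 0 < (x + (B - v)) %% B.
  case: (ltnP v x) => [ltvx|]; last first.
    by rewrite leq_eqVlt => /orP[]; [lia | move=> h; rewrite modn_small; lia].
  have -> : x + (B - v) = x - v + B by lia.
  by rewrite modnDr modn_small; lia.
rewrite (modn_small B1); case: b => /=; first by rewrite subnKC ?modnn // ltnW.
by rewrite subn0 modnDr modn_small.
Qed.

Lemma run_loop_setup w n k (b : bool) p (r m : nat -> nat) :
  k < n * n -> (n * n + 16 * n).+2 < 2 ^ w -> (k %/ n == k %% n -> ~~ b) ->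
  r 0 = 0 -> r 1 = n -> r 2 = 16 * n -> r 3 = n * n -> r 4 = k -> r 9 = 1 -> m k.+1 = b ->
  exists2 r' : nat -> nat,
    (forall d, d < 14 -> r' d = loop_regs n k b d) /\ (forall d, 16 <= d -> r' d = r d) &
    run w (State p r m) loop_setup = State (p + 14) r' m.
Proof.
move=> kn nw hb r0 r1 r2 r3 r4 r9 mk.
have n0 : 0 < n by lia.
have vn : k %/ n < n by rewrite ltn_divLR.
have xn : k %% n < n by rewrite ltn_mod.
rewrite /run /= r1 r4 r9.
have small a : a <= (n * n + 16 * n).+1 -> a %% 2 ^ w = a by move=> h; rewrite modn_small //; lia.
rewrite /word_op_eval (addn1 k) (small k.+1); last by lia.
have Sv : (k %/ n) %% 2 ^ w = k %/ n by apply: small; lia.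
have Sx : (k %% n) %% 2 ^ w = k %% n by apply: small; lia.
rewrite mk; eexists; last by rewrite (addnC p).
split=> [|d d16] /=; last by rewrite !gtn_eqF //; lia.
case=> [|[|[|[|[|[|[|[|[|[|[|[|[|[|d]]]]]]]]]]]]]] //= _;
  rewrite /loop_regs /= ?r0 ?r1 ?r2 ?r3 ?r4 ?r9 //.
all: rewrite ?Sv ?Sx.
- by apply: flag_mod => //; lia.
- by rewrite (small (_ + _)) ?addn1 ?small //; lia.
- by rewrite (small (_ + _)) ?(small (_ + _ + _)) ?addn1 ?small //; lia.
- by rewrite small //; lia.
- by rewrite (small 4) ?(small (4 * n)) ?small //; lia.
Qed.


(** * Cells written by the loop *)

Section LoopWrites.
Variables (n : nat) (e : rel 'I_n).
Hypothesis n0 : 0 < n.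

Definition adj : rel nat := fun x y => nth 0 (encode_graph e) (x * n + y).+1 != 0.
Definition nonadj : rel nat := fun x y => (x != y) && ~~ adj x y.

Lemma adjE (x y : 'I_n) : adj x y = e x y.
Proof. by rewrite /adj nth_encode_graph; case: e. Qed.

Lemma nth_adj x y : x < n -> y < n -> nth 0 (encode_graph e) (x * n + y).+1 = adj x y.
Proof.
move=> xn yn; rewrite -[x]/(val (Ordinal xn)) -[y]/(val (Ordinal yn)) adjE.
exact: nth_encode_graph.
Qed.

Local Notation final := (final_cell n adj nonadj).
Local Notation bit k := (adj (k %/ n) (k %% n)).

(** These addresses lie in rows below [n] of the gadget matrix, that is in the isolated block 0. *)
Lemma final_cell_low a : 0 < a -> a <= n * n -> final a = 0.
Proof.
case: a => // a _ an.
have N0 : 0 < 16 * n by lia.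
have -> : a.+1 = cell n (a %/ (16 * n)) (a %% (16 * n)) by rewrite /cell -divn_eq.
have lt_row : a %/ (16 * n) < n by rewrite ltn_divLR //; nia.
rewrite final_cell_edge ?ltn_pmod //; last by lia.
rewrite /edge /block_arc. by rewrite (divn_small lt_row) !inE !xpair_eqE !eqE /= ?andbF.
Qed.

Lemma loop_writes_final k : k < n * n ->
  all (fun s => final (write_addr n (loop_regs n k (bit k)) s)
                == write_value (loop_regs n k (bit k)) s) loop_writes.
Proof.
move=> kn.
have vn : k %/ n < n by rewrite ltn_divLR.
have xn : k %% n < n by rewrite ltn_mod.
rewrite /= /write_value /loop_regs /=.
set v := k %/ n in vn *; set x := k %% n in xn *.
rewrite !mul0n !add0n !addn0 final_cell_size !final_cell_pair //.
have -> : cell n 0 k = k.+1 by rewrite /cell.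
rewrite (@final_cell_low k.+1) // !final_cell_edge ?block_lt // /edge /block_arc.
rewrite !div_block // !mod_block // !inE !xpair_eqE !eqE /= !eqnE !eqxx ?andbF ?orbF ?andbT /=.
by rewrite !eqxx /nonadj; case: (v == x); case: (adj v x).
Qed.

(* The adjacency bit, here set to 0, does not affect the addresses written. *)
Definition visited (k : nat) : seq nat :=
  flatten [seq map (write_addr n (loop_regs n j 0)) loop_writes | j <- iota 0 k].

Lemma write_addr_bit k b s : s \in loop_writes ->
  write_addr n (loop_regs n k b) s = write_addr n (loop_regs n k 0) s.
Proof.
have H : all (fun s => write_addr n (loop_regs n k b) s == write_addr n (loop_regs n k 0) s)
    loop_writes by rewrite /= !eqxx.
by move=> sw; apply/eqP; move: s sw; apply/allP.
Qed.

Lemma visitedS k : visited k.+1 =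
  visited k ++ map (write_addr n (loop_regs n k 0)) loop_writes.
Proof. by rewrite /visited -addn1 iotaD map_cat flatten_cat [X in _ ++ X]cats0. Qed.

Lemma mem_visited k l a : k < l ->
  a \in map (write_addr n (loop_regs n k 0)) loop_writes -> a \in visited l.
Proof.
move=> kl ak; apply/flattenP; exists (map (write_addr n (loop_regs n k 0)) loop_writes) => //.
by apply/mapP; exists k => //; rewrite mem_iota.
Qed.

(** Apart from the erased cell, all written rows lie in block 1 or later, past the input matrix; so
    each iteration still finds its own adjacency bit in place. *)
Lemma loop_addrP k a : a \in map (write_addr n (loop_regs n k 0)) loop_writes ->
  a = k.+1 \/ n * n < a.
Proof.
have high b u v : n * n < cell n (b.+1 * n + u) v by rewrite /cell; nia.
have : all (fun a => (a == k.+1) || (n * n < a)) (map (write_addr n (loop_regs n k 0)) loop_writes).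
  by rewrite /= !high !orbT /= /cell /loop_regs /= eqxx.
by move=> /allP H /H /orP[/eqP|]; [left | right].
Qed.

Lemma loop_addr_lt k a : k < n * n ->
  a \in map (write_addr n (loop_regs n k 0)) loop_writes ->
  a < (16 * n * (16 * n) + n.*2).+2.
Proof.
move=> kn; move: a; apply/allP.
have vn : k %/ n < n by rewrite ltn_divLR.
have xn : k %% n < n by rewrite ltn_mod.
have vx := leq_mul (ltnW vn) (leqnn n).
rewrite /= /loop_regs /= /cell; move: (k %/ n) (k %% n) vn xn vx => v x vn xn vx.
by repeat (apply/andP; split => //); nia.
Qed.

Lemma not_visited k : k < n * n -> k.+1 \notin visited k.
Proof.
move=> kn; apply/negP => /flattenP[_ /mapP[j + ->]]; rewrite mem_iota => jk /loop_addrP; lia.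
Qed.

(** The iteration for the residues of [i] and [j] modulo [n] writes the arc in both directions; on a
    private path the residues agree. *)
Lemma arc_written i j : block_arc n adj nonadj i j ->
  let cells := map (write_addr n (loop_regs n (i %% n * n + j %% n) 0)) loop_writes in
  (cell n i j \in cells) && (cell n j i \in cells).
Proof.
have [ui uj] := (ltn_pmod i n0, ltn_pmod j n0).
rewrite [in cell n i j](divn_eq i n) [in cell n _ j](divn_eq j n).
rewrite [in cell n j i](divn_eq i n) [in cell n j _](divn_eq j n).
rewrite /= !inE /loop_regs /= div_block // mod_block //.
rewrite /block_arc !inE !xpair_eqE => /or3P[] /andP[]; last first.
  move=> + /eqP <-; do 4?case/orP; case/andP=> /eqP-> /eqP->; rewrite !eqxx ?orbT //.
by case/andP=> /eqP-> /eqP-> _; rewrite !eqxx ?orbT.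
by case/orP=> /andP[/eqP-> /eqP->] _; rewrite !eqxx ?orbT.
Qed.

(** The loop visits the input matrix, all cells of edges and the list of pairs; any other cell
    beyond 0 is zero in both instances. *)
Lemma final_cell_unvisited a : a != 0 -> a \notin visited (n * n) ->
  final a = nth 0 (encode_graph e) a.
Proof.
move=> a0 av.
have avk k : k < n * n -> a \notin map (write_addr n (loop_regs n k 0)) loop_writes.
  by move=> kn; apply: contraNN av; apply: mem_visited.
have an : n * n < a.
  rewrite ltnNge; apply/negP => an; have /negP := avk a.-1 ltac:(lia); apply.
  by rewrite /= !inE /cell /loop_regs /= !mul0n !add0n prednK ?eqxx ?orbT // lt0n.
rewrite [RHS]nth_default ?size_encode_graph //.
have N0 : 0 < 16 * n by lia.
have Ea : a = cell n (a.-1 %/ (16 * n)) (a.-1 %% (16 * n)).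
  by rewrite /cell -divn_eq prednK // lt0n.
have jN := ltn_pmod a.-1 N0.
move: Ea jN; set i := _ %/ _; set j := _ %% _ => Ea jN.
case: (ltnP i (16 * n)) => [iN|Ni].
  rewrite Ea final_cell_edge //; apply/eqP; rewrite eqb0; apply/negP => eij.
  have [ui uj] := (ltn_pmod i n0, ltn_pmod j n0).
  have := avk (i %% n * n + j %% n) ltac:(nia).
  have := avk (j %% n * n + i %% n) ltac:(nia).
  by rewrite Ea; case/orP: eij => /arc_written /andP[wij wji]; rewrite ?wij ?wji.
case: (leqP (16 * n * (16 * n) + n.*2).+2 a) => [/final_cell_out //|alt].
have Ei : i = 16 * n by move: alt; rewrite Ea /cell; nia.
have jn : j <= n.*2 by move: alt; rewrite Ea /cell Ei; lia.
case: (posnP j) => [j0|j0].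
  have /negP[] := avk 0 ltac:(nia).
  by rewrite Ea Ei j0 /= !inE /loop_regs /= !mul0n !addn0 eqxx !orbT.
(* Position 0 of this row holds the number of pairs, so pair [v] occupies positions [2 v + 1] and
   [2 v + 2]. *)
have [v vn jv] : exists2 v, v < n & j = v.*2.+1 \/ j = v.*2.+2 by exists j.-1./2; lia.
have /negP[] := avk (v * n + 0) ltac:(nia).
rewrite Ea Ei /= !inE /loop_regs /= !div_block // !mul0n !add0n !addn0 addnn.
by case: jv => ->; rewrite eqxx !orbT.
Qed.

End LoopWrites.

(** * Execution of the prelude *)

Section Prelude.
Variables (n : nat) (e : rel 'I_n).
Hypothesis n0 : 0 < n.
Local Notation adj := (adj e).
Local Notation nonadj := (nonadj e).
Local Notation final := (final_cell n adj nonadj).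
Local Notation bit k := (adj (k %/ n) (k %% n)).
Local Notation visited := (visited n).

(* The loop starts at address 5 and its exit is at address 221. *)
Definition loop_inv (k : nat) (s : state) : Prop :=
  [/\ pc s = (if k < n * n then 5 else 221),
      forall d, 16 <= d -> reg s d = 0,
      forall d, d \in [:: 0; 1; 2; 3; 4; 9] -> reg s d = loop_regs n k 0 d
    & forall a, memory s a = if a \in visited k then final a else nth 0 (encode_graph e) a].

Definition prelude_init : seq instr :=
  [:: ReadMem 1 0; SetConst 2 16; Oper OpMul 2 2 1; Oper OpMul 3 1 1; SetConst 9 1].

(** Register 0 being 0, this stores [16 n] in cell 0; the registers are then cleared because the
    simulated program starts with all of them zero. *)
Definition prelude_exit : seq instr :=
  WriteMem 0 2 :: [seq SetConst d 0 | d <- iota 0 16].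

Definition prelude : seq instr :=
  prelude_init ++ loop_body ++ JumpLt 4 3 5 :: prelude_exit.

Variables (w : nat) (post : seq instr).
Hypothesis e_irr : irreflexive e.
Hypothesis w_large : (16 * n * (16 * n) + n.*2).+2 < 2 ^ w.

Local Notation next := (step w (prelude ++ post)).

Lemma loop_step k s : k < n * n -> loop_inv k s -> loop_inv k.+1 (iter 216 next s).
Proof.
move=> kn; case: s => p r m [pE rhigh rlow mE].
rewrite kn in pE; rewrite /= in pE rhigh rlow mE.
have vn : k %/ n < n by rewrite ltn_divLR.
have xn : k %% n < n by rewrite ltn_mod.
set b := bit k.
have bdiag : k %/ n == k %% n -> ~~ b.
  by move/eqP=> E; rewrite /b E (adjE e (Ordinal xn) (Ordinal xn)) e_irr.
have mk : m k.+1 = b.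
  by rewrite mE (negbTE (not_visited n0 kn)) {1}(divn_eq k n) nth_adj.
have nw : (n * n + 16 * n).+2 < 2 ^ w by apply: leq_ltn_trans w_large; nia.
(* The setup takes 14 instructions, the 20 writes 10 each and the increment one; the jump is the
   216th. *)
rewrite -[216]/((size loop_body).+1) iterS.
have P1 : prelude ++ post = prelude_init ++ loop_body ++ (JumpLt 4 3 5 :: prelude_exit ++ post).
  by rewrite -catA -catA.
have P2 : prelude ++ post =
    (prelude_init ++ loop_body) ++ JumpLt 4 3 5 :: (prelude_exit ++ post).
  by rewrite P1 catA.
rewrite {2}P1 iter_run //.
rewrite pE /loop_body (run_cat _ _ loop_setup).
have [r1 [r1low r1high] ->] := @run_loop_setup w n k b 5 r m kn nw bdiag
  (rlow 0 isT) (rlow 1 isT) (rlow 2 isT) (rlow 3 isT) (rlow 4 isT) (rlow 9 isT) mk.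
rewrite (run_cat _ _ (flatten _)).
have writes14 : all (fun s => all (fun d => d < 14) (write_regs s)) loop_writes by [].
have Eaddr s : s \in loop_writes -> write_addr n r1 s = write_addr n (loop_regs n k 0) s.
  by move=> sw; rewrite (write_ext n (allP writes14 s sw) r1low).1 write_addr_bit.
have [||||| r2 Hr2 ->] := @run_writes w n (5 + 14) r1 m loop_writes.
- exact: r1low.
- exact: r1low.
- exact: r1low.
- by [].
- apply/allP => s sw; rewrite Eaddr //; apply: leq_ltn_trans w_large; apply: ltnW.
  by apply: (loop_addr_lt n0 kn); apply: map_f.
have Em : all (fun s => final (write_addr n r1 s) == write_value r1 s) loop_writes.
  apply/allP => s sw; have := allP (loop_writes_final e n0 kn) s sw.
  by rewrite write_addr_bit // Eaddr // (write_ext n (allP writes14 s sw) r1low).2.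
have [r24 r29 r23] : [/\ r2 4 = k, r2 9 = 1 & r2 3 = n * n] by rewrite !Hr2 // !r1low.
have k1 : (k + 1) %% 2 ^ w = k.+1 by rewrite addn1 modn_small //; lia.
have := apply_writesE m Em; move: (apply_writes n r1 loop_writes m) => m' Em'.
rewrite {1}P2 step_at // /run [foldl _ _ _]/= r24 r29 /word_op_eval k1 /exec.
have -> : [eta r2 with 4 |-> k.+1] 4 = k.+1 by [].
have -> : [eta r2 with 4 |-> k.+1] 3 = n * n by rewrite /= r23.
split=> [|d d16|d dl|a].
- by [].
- by rewrite /= gtn_eqF ?Hr2 ?r1high ?rhigh // ?inE ?gtn_eqF //; lia.
- have d14 : d < 14 by move: dl; rewrite !inE; lia.
  rewrite /=; case: eqP => [->|/eqP d4]; first by [].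
  rewrite Hr2 ?r1low //; last by rewrite !inE !ltn_eqF //; lia.
  by move: dl d4; rewrite !inE; do 5?[case/orP=> [/eqP-> //|]] => /eqP->.
have Emap : map (write_addr n r1) loop_writes =
    map (write_addr n (loop_regs n k 0)) loop_writes by apply/eq_in_map.
rewrite [memory _]/= Em' mE Emap visitedS mem_cat.
by do 2!case: (_ \in _).
Qed.

Lemma loop_run k s : k <= n * n -> loop_inv 0 s -> loop_inv k (iter (216 * k) next s).
Proof.
move=> + s0; elim: k => [|k IH] kn; first by rewrite muln0.
by rewrite mulnS iterD; apply: loop_step => //; apply: IH; apply: ltnW.
Qed.

(** Apart from the program counter, the state reached is the initial state on the gadget instance,
    so the simulation can start from it. *)
Lemma prelude_run :
  iter (5 + 216 * (n * n) + 17) next (init (encode_graph e)) =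
  State (size prelude) (fun=> 0) (nth 0 (gadget_input n adj nonadj)).
Proof.
rewrite addnC iterD addnC iterD.
have P1 : prelude ++ post =
    [::] ++ prelude_init ++ (loop_body ++ JumpLt 4 3 5 :: prelude_exit ++ post).
  by rewrite -catA -catA.
have P2 : prelude ++ post =
    (prelude_init ++ loop_body ++ [:: JumpLt 4 3 5]) ++ prelude_exit ++ post.
  by rewrite P1 -catA -catA.
have -> : iter 5 next (init (encode_graph e)) =
    run w (init (encode_graph e)) prelude_init by rewrite P1 -[5]/(size prelude_init) iter_run.
have /(loop_run (leqnn (n * n))) : loop_inv 0 (run w (init (encode_graph e)) prelude_init).
  have small a : a <= 16 * n * (16 * n) -> a %% 2 ^ w = a by move=> h; rewrite modn_small //; lia.
  split=> [|d d16|d|a].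
  - by rewrite muln_gt0 n0.
  - by rewrite /= !gtn_eqF //; lia.
  - rewrite !inE; do 5?case/orP; move/eqP->; rewrite /= /loop_regs /= ?div0n ?mod0n //.
    + by rewrite /word_op_eval modnMml small //; nia.
    + by rewrite /word_op_eval small //; nia.
    + by rewrite small //; nia.
  - by [].
move: (iter (216 * _) _ _) => [p r m [pE rhigh rlow mE]].
rewrite /= ltnn in pE rhigh rlow mE.
have -> : iter 17 next (State p r m) = run w (State p r m) prelude_exit.
  by rewrite P2 -[17]/(size prelude_exit) iter_run // pE.
have [r0 r2] : r 0 = 0 /\ r 2 = 16 * n by rewrite !rlow.
rewrite pE /run [foldl _ _ _]/= !mod0n r0 r2; congr State; apply: funext.
  by do 16?case=> //; move=> d; apply: rhigh.
case=> [|a] //=; rewrite mE; case: ifP => // /negbT av.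
by rewrite -[RHS]/(final a.+1) final_cell_unvisited.
Qed.

End Prelude.

(** * Simulation of the approximation algorithm *)

Section Simulation.
Variables (w : nat) (P pre post : seq instr).

(** Targets beyond the end of [P] are clipped, so that every halting run arrives at the first
    instruction of [post]. *)
Definition shift_instr (c : instr) : instr :=
  match c with
  | JumpLt x y l => JumpLt x y (size pre + minn l (size P))
  | JumpEq x y l => JumpEq x y (size pre + minn l (size P))
  | _ => c
  end.

Definition shift_state (s : state) : state :=
  State (size pre + minn (pc s) (size P)) (reg s) (memory s).

Local Notation Q := (pre ++ map shift_instr P ++ post).

Lemma iter_halted t s : halted P s -> iter t (step w P) s = s.
Proof. by move=> hs; elim: t => //= t ->; rewrite /step hs. Qed.

Lemma shift_step s : ~~ halted P s -> step w Q (shift_state s) = shift_state (step w P s).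
Proof.
move=> hs; rewrite {2}/step (negbTE hs); move: hs; rewrite /halted -ltnNge => ps.
have psQ : size pre + pc s < size Q by rewrite !size_cat size_map; lia.
rewrite /step /halted /= (minn_idPl (ltnW ps)) (leqNgt _ (_ + _)) psQ /=.
rewrite nth_cat ifF; last by lia.
rewrite addKn nth_cat size_map ps (nth_map (SetConst 0 0)) //.
case: s ps {psQ} => p r m /= ps; case: (nth _ _ _) => [d c|o d x y|d x|x y|x y l|x y l] /=;
  rewrite /shift_state /=.
- by rewrite (minn_idPl ps) addnS.
- by rewrite (minn_idPl ps) addnS.
- by rewrite (minn_idPl ps) addnS.
- by rewrite (minn_idPl ps) addnS.
- by case: ifP => // _; rewrite (minn_idPl ps) addnS.
- by case: ifP => // _; rewrite (minn_idPl ps) addnS.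
Qed.

Lemma pc_shift s : halted P s -> pc (shift_state s) = size pre + size P.
Proof. by move=> /minn_idPr /= ->. Qed.

(** The relocated program moves on into [post] once [P] halts, so [t'] counts only the steps before
    halting. *)
Lemma shift_run t s : halted P (iter t (step w P) s) ->
  exists2 t', t' <= t &
    iter t' (step w Q) (shift_state s) = shift_state (iter t (step w P) s).
Proof.
elim: t s => [|t IH] s; first by exists 0.
case: (boolP (halted P s)) => [hs _|hs]; first by exists 0; rewrite // iter_halted.
by rewrite iterSr => /IH[t' t't E]; exists t'.+1; rewrite // iterSr shift_step.
Qed.

Definition bounded (s : state) : Prop :=
  (forall d, reg s d < 2 ^ w) /\ (forall a, memory s a < 2 ^ w).

Lemma bounded_step s : bounded s -> bounded (step w P s).
Proof.
rewrite /step; case: ifP => // _; case: s => p r m [/= br bm].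
have B0 : 0 < 2 ^ w by rewrite expn_gt0.
by case: (nth _ _ _) => [d c|o d x y|d x|x y|x y l|x y l]; split=> //= a;
  case: ifP => // _; rewrite ?ltn_pmod.
Qed.

Lemma bounded_iter t s : bounded s -> bounded (iter t (step w P) s).
Proof. by move=> bs; elim: t => //= t; apply: bounded_step. Qed.

Lemma bounded_init input : fits w input -> bounded (init input).
Proof.
case=> _ /allP h; split=> a /=; first by rewrite expn_gt0.
case: (ltnP a (size input)) => [ai|ai]; first by apply/h/mem_nth.
by rewrite nth_default // expn_gt0.
Qed.

End Simulation.

(* Accepts when the estimate left by the simulated program is at least 5. *)
Definition verdict : seq instr :=
  [:: SetConst 0 0; ReadMem 1 0; SetConst 2 1; ReadMem 2 2; Oper OpDiv 1 1 2;
      SetConst 2 5; Oper OpDiv 1 1 2; WriteMem 0 1].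

(** Two successive floor divisions amount to one by [5 * m 1], a product that could overflow; the
    quotient is non-zero exactly when the fraction is at least 5. *)
Lemma run_verdict w p r m : 5 < 2 ^ w -> m 0 < 2 ^ w -> 0 < m 1 ->
  (memory (run w (State p r m) verdict) 0 != 0) = (5 * m 1 <= m 0).
Proof.
move=> w5 m0 m1.
rewrite /run /= !(modn_small w5) mod0n modn_small; last by lia.
rewrite /word_op_eval.
have q : m 0 %/ m 1 < 2 ^ w by apply: leq_ltn_trans m0; apply: leq_div.
rewrite (modn_small q) modn_small; last by apply: leq_ltn_trans q; apply: leq_div.
by rewrite -lt0n divn_gt0 // leq_divRL.
Qed.

Definition reduction_program (P : seq instr) : seq instr :=
  prelude ++ map (shift_instr P prelude) P ++ verdict.

(** Multiplying [n] by 16 adds 4 to its logarithm; the offset compensates, so that both instances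
    have the same word length. *)
Definition reduction (A : algorithm) : algorithm :=
  Algorithm (reduction_program (program A)) (word_slope A) (4 * word_slope A + word_offset A).

Lemma trunc_log_16 n : 0 < n -> trunc_log 2 (16 * n) = 4 + trunc_log 2 n.
Proof.
by move=> n0; rewrite -[16]/(2 * (2 * (2 * 2))) -!mulnA !trunc_logMp ?muln_gt0 ?n0.
Qed.

Lemma word_length_reduction A n : 0 < n ->
  word_length (reduction A) n = word_length A (16 * n).
Proof. by move=> n0; rewrite /word_length trunc_log_16 //=; lia. Qed.

Lemma reduction_correct (A : algorithm) n (e : rel 'I_n) t :
  let w := word_length A (16 * n) in
  let s := iter t (step w (program A)) (init (gadget_input n (adj e) (nonadj e))) in
  0 < n -> irreflexive e -> fits w (gadget_input n (adj e) (nonadj e)) ->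
  halted (program A) s -> 0 < memory s 1 ->
  exists2 t', t' <= 216 * (n * n) + 30 + t &
    let s' := iter t' (step w (program (reduction A))) (init (encode_graph e)) in
    halted (program (reduction A)) s' /\
    (memory s' 0 != 0) = (5 * memory s 1 <= memory s 0).
Proof.
move=> w s n0 eirr fit hs m1.
have w_large : (16 * n * (16 * n) + n.*2).+2 < 2 ^ w.
  by have [] := fit; rewrite size_gadget_input.
set P := program A in hs *.
have [t1 t1t E1] := shift_run prelude verdict hs.
have QE : program (reduction A) = prelude ++ map (shift_instr P prelude) P ++ verdict by [].
have QE' : program (reduction A) = (prelude ++ map (shift_instr P prelude) P) ++ verdict ++ [::].
  by rewrite QE cats0 catA.
(* Besides the loop, the prelude takes 5 + 17 steps and [verdict] 8, which gives the 30. *)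
exists (size verdict + (t1 + (5 + 216 * (n * n) + 17))).
  by rewrite [size verdict]/=; lia.
have shiftE : State (size prelude) (fun=> 0) (nth 0 (gadget_input n (adj e) (nonadj e))) =
    shift_state P prelude (init (gadget_input n (adj e) (nonadj e))).
  by rewrite /shift_state min0n addn0.
have -> : iter (size verdict + (t1 + (5 + 216 * (n * n) + 17)))
    (step w (program (reduction A))) (init (encode_graph e)) =
    run w (shift_state P prelude s) verdict.
  rewrite iterD iterD [in iter (_ + 17) _]QE prelude_run // shiftE [in iter t1 _]QE E1 QE'.
  by rewrite iter_run // pc_shift // size_cat size_map.
have bs : bounded w s by apply/bounded_iter/bounded_init.
split; last by apply: run_verdict => //; [nia | apply: bs.2].
by rewrite /halted QE pc_run // pc_shift // !size_cat size_map addnA.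
Qed.

(** * Lower bound by unread cells *)

Section UnreadCells.
Variables (w : nat) (P : seq instr).

Lemma halted_unique t t' s :
  halted P (iter t (step w P) s) -> halted P (iter t' (step w P) s) ->
  iter t (step w P) s = iter t' (step w P) s.
Proof.
wlog tt' : t t' / t <= t' => [H|] ht ht'.
  by case: (leqP t t') => [|/ltnW] /H; [apply | move=> /(_ ht' ht)].
by rewrite -(subnK tt') iterD (iter_halted _ _ ht).
Qed.

(* The value is the junk [0] when the next step reads nothing. *)
Definition read_addr (s : state) : nat :=
  if nth (SetConst 0 0) P (pc s) is ReadMem _ x then reg s x else 0.

Definition agree_off (D : seq nat) (s s' : state) : Prop :=
  [/\ pc s = pc s', reg s = reg s' & forall a, a \notin D -> memory s a = memory s' a].

Lemma agree_step D s s' : agree_off D s s' -> read_addr s \notin D ->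
  agree_off D (step w P s) (step w P s').
Proof.
case: s => p r m; case: s' => p' r' m' [/= <- <- mE]; rewrite /read_addr /step /halted /=.
case: ifP => // _; case: (nth _ _ _) => [d c|o d x y|d x|x y|x y l|x y l] //= rD; split=> //=.
- by rewrite mE.
- by move=> a aD; case: eqP => // _; apply: mE.
Qed.

Lemma agree_run D t s s' : agree_off D s s' ->
  (forall i, i < t -> read_addr (iter i (step w P) s) \notin D) ->
  agree_off D (iter t (step w P) s) (iter t (step w P) s').
Proof.
move=> ss'; elim: t => [|t IH] rD //=.
by apply: agree_step; [apply: IH => i it; apply: rD; lia | apply: rD].
Qed.

End UnreadCells.

(** * Gadgets differing in one middle edge *)

Definition full_rel : rel nat := fun _ _ => true.
Definition empty_rel : rel nat := fun _ _ => false.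
Definition single_rel (x y : nat) : rel nat := fun u v => (u == x) && (v == y).

Definition toggled (n x y : nat) : seq nat :=
  [:: cell n (2 * n + x) (3 * n + y); cell n (3 * n + y) (2 * n + x)].

Lemma single_block_arc n x y i j : 0 < n -> ~~ block_arc n full_rel empty_rel i j ->
  block_arc n full_rel (single_rel x y) i j -> i = 2 * n + x /\ j = 3 * n + y.
Proof.
move=> n0; rewrite /block_arc /single_rel /empty_rel /full_rel !andbT andbF /= => /norP[H1 H3].
rewrite (negbTE H1) (negbTE H3) orbF /= => /andP[/eqP[i2 j3] /andP[/eqP ix /eqP jy]].
by rewrite (divn_eq i n) (divn_eq j n) i2 j3 ix jy.
Qed.

Lemma empty_block_arc n x y i j : block_arc n full_rel empty_rel i j ->
  block_arc n full_rel (single_rel x y) i j.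
Proof.
by rewrite /block_arc /empty_rel andbF /= => /orP[->|->] //; rewrite !orbT.
Qed.

Lemma toggled_input n x y a : 0 < n -> a \notin toggled n x y ->
  nth 0 (gadget_input n full_rel empty_rel) a = nth 0 (gadget_input n full_rel (single_rel x y)) a.
Proof.
move=> n0; rewrite -!/(final_cell _ _ _ _).
case: (posnP a) => [-> _|a0]; first by [].
have N0 : 0 < 16 * n by lia.
case: (leqP (cell n (16 * n) 0) a) => [tail _|].
  have -> : a = cell n (16 * n) (a - cell n (16 * n) 0) by move: tail; rewrite /cell; lia.
  by rewrite !final_cell_tail.
have -> : a = cell n (a.-1 %/ (16 * n)) (a.-1 %% (16 * n)).
  by rewrite /cell -divn_eq prednK // lt0n.
have := ltn_pmod a.-1 N0; move: (_ %/ _) (_ %% _) => i j jN ai.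
have iN : i < 16 * n by move: ai; rewrite /cell; nia.
rewrite !final_cell_edge // !inE => /norP[/eqP D1 /eqP D2]; congr nat_of_bool.
apply/idP/idP => [/orP[]|].
- by move=> H; apply/orP; left; apply: empty_block_arc.
- by move=> H; apply/orP; right; apply: empty_block_arc.
rewrite /edge; case: (boolP (block_arc n full_rel empty_rel i j)) => //= H1.
case: (boolP (block_arc n full_rel empty_rel j i)) => //= H2.
by case/orP=> [/(single_block_arc n0 H1)|/(single_block_arc n0 H2)] [ix jy];
  [case: D1 | case: D2]; rewrite ix jy.
Qed.

(** Inverts [toggled]: as [2 n + x < 3 n + y], the smaller coordinate of the cell gives [x] and the
    larger [y]. *)
Definition toggled_pair (n a : nat) : nat * nat :=
  let i := a.-1 %/ (16 * n) in let j := a.-1 %% (16 * n) in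
  (minn i j - 2 * n, maxn i j - 3 * n).

Lemma toggled_pairE n x y a : x < n -> y < n -> a \in toggled n x y -> toggled_pair n a = (x, y).
Proof.
move=> xn yn; have N0 : 0 < 16 * n by lia.
have [x16 y16] : 2 * n + x < 16 * n /\ 3 * n + y < 16 * n by lia.
rewrite !inE /toggled_pair => /orP[] /eqP-> /=;
  rewrite !divnMDl // !modnMDl !divn_small // !modn_small // addn0;
  congr pair; lia.
Qed.

(* A read touches a cell of at most one pair. *)
Lemma unread_pair n t (reads : nat -> nat) : t < n * n ->
  exists x y : 'I_n, forall i, i < t -> reads i \notin toggled n x y.
Proof.
move=> tn.
pose L := [seq toggled_pair n (reads i) | i <- iota 0 t].
pose pairs := [seq (val x, val y) | x <- enum 'I_n, y <- enum 'I_n].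
have : ~~ all (fun p => p \in L) pairs.
  apply/negP => /allP sub.
  have up : uniq pairs.
    by apply: allpairs_uniq; rewrite ?enum_uniq // => -[a b] [c d] _ _ [/val_inj-> /val_inj->].
  have := uniq_leq_size up sub.
  by rewrite size_allpairs !size_enum_ord size_map size_iota leqNgt tn.
case/allPn => _ /allpairsP[[x y] /= [_ _ ->]] xyL; exists x, y => i it.
apply: contraNN xyL => iD; apply/mapP; exists i; first by rewrite mem_iota.
by rewrite (toggled_pairE _ _ iD).
Qed.

(** The run on the modified instance mirrors the first one for [t] steps, hence is halted by then,
    and halted states no longer change. *)
Lemma indistinguishable w P n t : 0 < n -> t < n * n ->
  let s := iter t (step w P) (init (gadget_input n full_rel empty_rel)) in
  halted P s ->
  exists x y : 'I_n, forall t',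
    let s' := iter t' (step w P) (init (gadget_input n full_rel (single_rel x y))) in
    halted P s' -> memory s' 0 = memory s 0 /\ memory s' 1 = memory s 1.
Proof.
move=> n0 tn s hs.
have [x [y xyD]] := unread_pair
  (fun i => read_addr P (iter i (step w P) (init (gadget_input n full_rel empty_rel)))) tn.
exists x, y => t' s' hs'.
have [|pE rE mE] := agree_run (D := toggled n x y)
  (s' := init (gadget_input n full_rel (single_rel x y))) _ xyD.
  by split=> //= a aD; apply: toggled_input.
have hs2 : halted P (iter t (step w P) (init (gadget_input n full_rel (single_rel x y)))).
  by rewrite /halted -pE.
rewrite /s' (halted_unique hs' hs2) !mE // !inE /cell; lia.
Qed.

(** * The two ranges of the exponent *)

Local Open Scope ring_scope.

(** * The gap between 3 and 5 *)

Section Estimate.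
Variables (R : realType) (alpha : R) (x m0 m1 : nat).
Hypotheses (m1_gt0 : (0 < m1)%N) (x_le : (x%:R : R) <= m0%:R / m1%:R)
  (le_x : (m0%:R / m1%:R : R) <= alpha * x%:R).

Lemma estimate_ge5 : (5 <= x)%N -> (5 * m1 <= m0)%N.
Proof.
move=> x5; have := le_trans (_ : (5%:R : R) <= x%:R) x_le.
by rewrite ler_nat x5 ler_pdivlMr ?ltr0n // -natrM ler_nat; apply.
Qed.

Lemma estimate_lt5 : alpha < 5 / 3 -> (x <= 3)%N -> (m0 < 5 * m1)%N.
Proof.
move=> alpha_lt x3; rewrite -(ltr_nat R) natrM -ltr_pdivrMr ?ltr0n //.
apply: le_lt_trans le_x _.
have : (x%:R : R) <= 3 by rewrite (ler_nat R x 3).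
have : 0 <= (x%:R : R) by rewrite ler0n.
(* For [alpha >= 0] the product is at most [3 * alpha < 5]; for negative [alpha] it is at most 0. *)
by case: (lerP 0 alpha); nra.
Qed.

End Estimate.

(** Since [(16 n)^tau * (16 n)^(2 - tau) = 256 n^2], it suffices that [(16 n)^(2 - tau)] exceed
    [256 |C|], which holds for large [n] because [2 - tau > 0]. *)
Lemma sub_quadratic (R : realType) (C tau : R) : tau < 2 ->
  exists2 n : nat, (0 < n)%N & C * (16 * n)%:R `^ tau < (n * n)%:R.
Proof.
move=> tau2; pose M : R := 256 * `|C| + 1; pose y := M `^ (2 - tau)^-1.
have M0 : 0 < M by rewrite /M; have := normr_ge0 C; lra.
have d0 : 0 < 2 - tau by lra.
pose n := (Num.truncn y).+1; exists n => //.
have y0 : 0 <= y by apply: powR_ge0.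
have yn : y <= (16 * n)%:R.
  by apply: le_trans (ltW (truncnS_gt y)) _; rewrite ler_nat leq_pmull.
have N0 : 0 < (16 * n)%:R :> R by rewrite ltr0n.
have MN : M <= (16 * n)%:R `^ (2 - tau).
  have -> : M = y `^ (2 - tau) by rewrite -powRrM mulVf ?powRr1 ?ltW // gt_eqF.
  by apply: ge0_ler_powR => //; rewrite ?nnegrE; apply: ltW.
have N2 : (16 * n)%:R `^ tau * (16 * n)%:R `^ (2 - tau) = 256 * (n * n)%:R :> R.
  rewrite -powRD; last by rewrite (gt_eqF N0) implybT.
  rewrite addrCA subrr addr0 (powR_mulrn 2) ?ltW // expr2 -!natrM.
  by congr (_%:R); lia.
have P0 : 0 < (16 * n)%:R `^ tau :> R by apply: powR_gt0.
have := ler_norm C; rewrite -/n in N2 P0 MN *.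
move: ((16 * n)%:R `^ tau) ((16 * n)%:R `^ (2 - tau)) ((n * n)%:R) N2 P0 MN.
rewrite /M; move: `|C| => c p q r pq p0 Mq Cc.
have := ler_wpM2r (ltW p0) Cc; have := ler_wpM2l (ltW p0) Mq. lra.
Qed.

(** * Consequences of an approximation algorithm *)

Section Main.
Variables (R : realType) (alpha : R) (K : nat) (A : algorithm) (C tau : R).
Hypotheses (halpha : alpha < 5 / 3) (hK : (0 < K)%N).
Hypothesis A_approx : approximates_pairs_diameter_in alpha K A (fun n => C * n%:R `^ tau).

Lemma gadget_estimate n E f : (0 < n)%N ->
  let w := word_length A (16 * n) in
  fits w (gadget_input n E f) /\
  exists t : nat, let s := iter t (step w (program A)) (init (gadget_input n E f)) in
  [/\ t%:R <= C * (16 * n)%:R `^ tau, halted (program A) s, (0 < memory s 1)%N,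
     (5 <= pairs_diameter (gadget (n := n) E f) (gadget_pairs n))%N ->
       (5 * memory s 1 <= memory s 0)%N
   & (pairs_diameter (gadget (n := n) E f) (gadget_pairs n) <= 3)%N ->
       (memory s 0 < 5 * memory s 1)%N].
Proof.
move=> n0 w.
have N0 : (0 < 16 * n)%N by lia.
have psK : (0 < size (gadget_pairs n) <= K * (16 * n))%N by rewrite size_gadget_pairs; nia.
have [fit [t [tC hs [m1 /andP[xq qx]]]]] :=
  A_approx N0 (gadget_simple n E f) psK (gadget_pairs_connected n E f).
split=> //; exists t; split=> //.
- exact: estimate_ge5 xq.
- exact: estimate_lt5 qx halpha.
Qed.

Lemma sub_quadratic_impossible : tau < 2 -> False.
Proof.
move=> /(sub_quadratic C)[n n0 Cn].
have [_ [t [tC hs m1 H5 _]]] := gadget_estimate full_rel empty_rel n0.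
have tn : (t < n * n)%N by rewrite -(ltr_nat R); apply: le_lt_trans tC Cn.
have [x [y H]] := indistinguishable n0 tn hs.
(* As the outer relation is full, the single edge from [x] to [y] serves every [v]: the maximum
   drops to at most 3 while the output is the same. *)
have [_ [t' [_ /H[E0 E1] _ _ H3]]] := gadget_estimate full_rel (single_rel x y) n0.
have : (5 * memory (iter t (step (word_length A (16 * n)) (program A))
    (init (gadget_input n full_rel empty_rel))) 1 <=
  memory (iter t (step (word_length A (16 * n)) (program A))
    (init (gadget_input n full_rel empty_rel))) 0)%N.
  by apply: H5; apply: (@gadget_diam_ge n full_rel empty_rel x).
rewrite leqNgt -E0 -E1 H3 //; apply: gadget_diam_le => v; exists x, y.
by rewrite /single_rel !eqxx.
Qed.

(** A walk of length 3 from [s_v] to [t_v] amounts to two distinct non-adjacent neighbours of [v],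
    the very obstruction to [v] being simplicial. *)
Lemma simplicial_estimate n (e : rel 'I_n) : simple_graph e ->
  if [exists v, simplicial e v]
  then (5 <= pairs_diameter (gadget (n := n) (adj e) (nonadj e)) (gadget_pairs n))%N
  else (pairs_diameter (gadget (n := n) (adj e) (nonadj e)) (gadget_pairs n) <= 3)%N.
Proof.
case=> e_sym e_irr; case: ifPn => [/existsP[v simp]|nsimp].
  apply: (@gadget_diam_ge _ _ _ v) => x y; rewrite /nonadj !adjE => vx /andP[xy].
  apply: contraNN => yv; move/forallP/(_ x)/forallP/(_ y)/implyP: simp; apply.
  by rewrite vx (e_sym v y) yv; apply: contraNneq xy => ->.
apply: gadget_diam_le => v; move: nsimp; rewrite negb_exists => /forallP/(_ v).
rewrite negb_forall => /existsP[x]; rewrite negb_forall => /existsP[y].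
rewrite negb_imply => /andP[/and3P[vx vy xy] nxy]; exists x, y.
by rewrite /nonadj !adjE vx (e_sym y v) vy nxy andbT.
Qed.

Lemma reduction_detects : 2 <= tau ->
  detects_simplicial_in (reduction A) (fun n => (246 + C * 16 `^ tau) * n%:R `^ tau).
Proof.
move=> tau2 n e n0 e_simple.
rewrite /computes_within word_length_reduction //.
have [fit [t [tC hs m1 H5 H3]]] := gadget_estimate (adj e) (nonadj e) n0.
have [t' t't [hs' acc]] := reduction_correct n0 e_simple.2 fit hs m1.
split; last first.
  exists t'; split=> //.
    (* For [n >= 1] the overhead [216 n^2 + 30] is at most [246 n^2], and [n^2 <= n^tau]; the
       simulated run contributes [C (16 n)^tau]. *)
    rewrite mulrDl -mulrA -powRM ?ler0n //.
    rewrite -(natrM R 16); apply: (le_trans (_ : _ <= (246 * (n * n) + t)%:R)).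
      by rewrite ler_nat; nia.
    rewrite natrD lerD // natrM ler_wpM2l ?ler0n // natrM -expr2 -powR_mulrn ?ler0n //.
    by apply: ler_powR; rewrite ?ler1n.
  have := simplicial_estimate e_simple; rewrite acc.
  by case: ifP => _ => [/H5|/H3]; rewrite // ltnNge => /negbTE.
have [szw _] := fit; move: szw; rewrite size_gadget_input => szw.
split; first by rewrite size_encode_graph; nia.
apply/allP => a; rewrite inE => /orP[/eqP->|/allpairsP[p [_ _ ->]]]; first by nia.
by case: (e _ _); nia.
Qed.

End Main.
Local Open Scope ring_scope.

Theorem theorem10 (R : realType) (F : fieldType)
    (SVH : simplicial_vertex_hypothesis R F)
    (alpha : R) (halpha : alpha < 5 / 3)
    (K : nat) (hK : (0 < K)%N)
    (eps : R) (heps : 0 < eps) :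
  ~ exists (A : algorithm) (C : R),
      approximates_pairs_diameter_in alpha K A
        (fun n => C * n%:R `^ (omega R F - eps)).
Proof.
case=> A [C A_approx].
case: (lerP 2 (omega R F - eps)) => tau2; last first.
  exact: sub_quadratic_impossible halpha hK A_approx tau2.
apply: (SVH eps heps); exists (reduction A), (246 + C * 16 `^ (omega R F - eps)).
exact: reduction_detects halpha hK A_approx tau2.
Qed.
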